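(* Let $\mathcal{T}$ be a radial grid with line resistances $r_{ef}$ and reactances $x_{ef}$, with nodal voltage magnitudes $v$ given by the linear coupled power flow model from random injections $p,q$ that are uncorrelated across distinct nodes. Let $a$ and $b$ be distinct terminal nodes with common parent node $k_1$. Let $c$ be another terminal node (distinct from $a$ and $b$) such that $c,k_1\in\mathcal{D}_{k_2}$ and $\mathcal{P}_{k_1}\cap\mathcal{P}_c=\mathcal{P}_{k_2}$ for some intermediate node $k_2$. For $e\in\{a,b,k_1\}$ let $$r^{k_2}_e=\sum_{(fg)\in\mathcal{P}_e\setminus\mathcal{P}_{k_2}}r_{fg},\qquad x^{k_2}_e=\sum_{(fg)\in\mathcal{P}_e\setminus\mathcal{P}_{k_2}}x_{fg}$$ be the sums of the resistances and of the reactances, respectively, of the lines on the path from $e$ to $k_2$. Then $$\begin{aligned}\phi_{ac}-\phi_{bc}={}&\Omega_p(a,a)\left((r^{k_2}_a)^2-(r^{k_2}_{k_1})^2\right)+\Omega_q(a,a)\left((x^{k_2}_a)^2-(x^{k_2}_{k_1})^2\right)+2\,\Omega_{pq}(a,a)\left(r^{k_2}_a x^{k_2}_a-r^{k_2}_{k_1}x^{k_2}_{k_1}\right)\\&-\Omega_p(b,b)\left((r^{k_2}_b)^2-(r^{k_2}_{k_1})^2\right)-\Omega_q(b,b)\left((x^{k_2}_b)^2-(x^{k_2}_{k_1})^2\right)-2\,\Omega_{pq}(b,b)\left(r^{k_2}_b x^{k_2}_b-r^{k_2}_{k_1}x^{k_2}_{k_1}\right).\end{aligned}$$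
   Context: Radial grid: $\mathcal{T}$ is a finite tree with node set $\mathcal{V}^{\mathcal{T}}$ and (operational) undirected edge set $\mathcal{E}^{\mathcal{T}}$, rooted at a distinguished node (the substation, or reference node). Each edge $(ef)\in\mathcal{E}^{\mathcal{T}}$ has a resistance $r_{ef}>0$ and a reactance $x_{ef}>0$. For a node $a$, $\mathcal{P}_a$ denotes the set of edges on the unique path from $a$ to the root. A node $c$ is a descendant of $a$ if the path from $c$ to the root passes through $a$. $\mathcal{D}_a$ is the set of descendants of $a$, with $a\in\mathcal{D}_a$. If $(ac)\in\mathcal{E}^{\mathcal{T}}$ and $c$ is a descendant of $a$, then $a$ is the parent of $c$ and $c$ is a child of $a$. Terminal nodes are the (non-root) leaf nodes of the tree; the remaining non-root nodes are called intermediate nodes. Linear coupled power flow (LC-PF) model: let $p,q,v$ be the vectors, indexed by the non-root nodes, of active power injections, reactive power injections and voltage magnitudes (the latter measured relative to the reference node). Let $H_{1/r}$ (respectively $H_{1/x}$) be the reduced weighted Laplacian of $\mathcal{T}$: the weighted graph Laplacian with edge weights $1/r_{ef}$ (respectively $1/x_{ef}$) with the row and column of the root removed. Then $$v=H_{1/r}^{-1}p+H_{1/x}^{-1}q.$$ The root's voltage magnitude is a deterministic constant. Statistics: $p$ and $q$ are real random vectors with finite second moments. For random vectors $X,Y$, $\mu_X=\mathbb{E}[X]$ and $\Omega_{XY}=\mathbb{E}[(X-\mu_X)(Y-\mu_Y)^T]$, with $\Omega_X=\Omega_{XX}$. Standing assumption: for all non-root nodes $e\neq f$, $\Omega_p(e,f)=\Omega_q(e,f)=\Omega_{qp}(e,f)=0$.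 For two nodes $e,f$, define $\phi_{ef}=\mathbb{E}\left[\left((v_e-\mu_{v_e})-(v_f-\mu_{v_f})\right)^2\right]$, the variance of the difference of voltage magnitudes at $e$ and $f$. *)

(* Defs.v *)
From mathcomp Require Import all_boot all_order all_algebra.
From mathcomp Require Import all_classical all_reals all_analysis.

Set Implicit Arguments.
Unset Strict Implicit.
Unset Printing Implicit Defensive.

Import Order.TTheory GRing.Theory Num.Theory.
Local Open Scope ring_scope.

Section Trees.
Variables (V : finType) (adj : rel V).

(* [ucycleb] also accepts the empty cycle and the back-and-forth closed walk
   along one edge; genuine cycles have at least three nodes. *)
Definition is_tree : Prop :=
  [/\ symmetric adj, irreflexive adj,
      (forall x y, connect adj x y)
    & (forall s : seq V, (2 < size s)%N -> ~~ ucycleb adj s)].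

Definition edges : {set {set V}} :=
  [set [set u.1; u.2] | u : V * V & adj u.1 u.2].

Variable root : V.

(* [a :: s] is the node sequence of a simple path from [a] to the root; in a
   tree there is exactly one such [s]. *)
Definition is_root_path (a : V) (s : seq V) : bool :=
  [&& path adj a s, last a s == root & uniq (a :: s)].

Definition root_edges (a : V) : {set {set V}} :=
  [set E : {set V} | `[< exists2 s, is_root_path a s &
     E \in pairmap (fun x y => [set x; y]%SET) a s >]]%SET.

Definition descendants (a : V) : {set V} :=
  [set c : V | `[< exists2 s, is_root_path c s & a \in c :: s >]]%SET.

Definition is_parent (a c : V) : bool := adj a c && (c \in descendants a).

Definition is_leaf (a : V) : bool := #|[pred y | adj a y]| == 1%N.

Definition terminal (a : V) : bool := (a != root) && is_leaf a.

Definition intermediate (a : V) : bool := (a != root) && ~~ is_leaf a.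

End Trees.

Notation nonroot root := {x | x != root}.

Section Laplacian.
Variables (R : realType) (V : finType) (adj : rel V) (root : V).

(* Edge weights are functions of the unordered pair of end nodes. *)
Definition laplacian (w : {set V} -> R) (e f : V) : R :=
  if e == f then \sum_(g | adj e g) w [set e; g]%SET
  else if adj e f then - w [set e; f]%SET else 0.

Definition reduced_laplacian (w : {set V} -> R) : 'M[R]_#|{: nonroot root}| :=
  \matrix_(i, j) laplacian w (val (enum_val i)) (val (enum_val j)).

End Laplacian.

Section PowerFlow.
Variables (d : measure_display) (Omega : measurableType d) (R : realType).
Variables (P : probability Omega R).
Variables (V : finType) (adj : rel V) (root : V) (r x : {set V} -> R).

Definition lcpf (p q : nonroot root -> Omega -> R) (v : V -> Omega -> R) : Prop :=
  (exists v0 : R, forall w, v root w = v0) /\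
  (forall w,
     \col_i v (val (enum_val i)) w =
       invmx (reduced_laplacian adj root (fun E => (r E)^-1))
         *m (\col_i p (enum_val i) w)
       + invmx (reduced_laplacian adj root (fun E => (x E)^-1))
         *m (\col_i q (enum_val i) w)).

Definition phi (v : V -> Omega -> R) (e f : V) : \bar R :=
  ('E_P[(fun w => ((v e w - fine 'E_P[v e]%E) - (v f w - fine 'E_P[v f]%E)) ^+ 2)%R])%E.

(* Path from [e] to [k], when [e] is a descendant of [k]. *)
Definition path_sum (z : {set V} -> R) (k e : V) : R :=
  \sum_(E in root_edges adj root e :\: root_edges adj root k) z E.

End PowerFlow.

(* Main.v *)
Require Import Defs.
From mathcomp Require Import all_boot all_order all_algebra.
From mathcomp Require Import all_classical all_reals all_analysis.
From mathcomp Require Import ring.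

Set Implicit Arguments.
Unset Strict Implicit.
Unset Printing Implicit Defensive.

Import Order.TTheory GRing.Theory Num.Theory.
Local Open Scope ring_scope.

(* The inverse of the reduced Laplacian with weights 1/z has as (e, f) entry the
   sum M(e, f) of z over the edges shared by the paths from e and from f to the
   root. As injections at distinct nodes are uncorrelated, phi_ef is a sum over
   the nodes g of the variance contributed by the injections at g, in which only
   the differences M(e, g) - M(f, g) enter. The siblings a and b have the same
   shared weights with every node other than a and b, so in phi_ac - phi_bc only
   g = a and g = b survive; there M(a, a) - M(c, a) and M(b, a) - M(c, a) are the
   weights of the paths from a, respectively k1, to k2. *)

(** * Paths to the root in a tree *)

Section RootedTree.
Variables (V : finType) (adj : rel V) (root : V).
Hypothesis tree : is_tree adj.

Let adjC : symmetric adj. Proof. by case: tree. Qed.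

(* Two distinct simple paths that leave [a] through different neighbours would
   close up, at the first node where they meet again, into a cycle. *)
Lemma simple_path_unique a s t :
  path adj a s -> path adj a t -> last a s = last a t ->
  uniq (a :: s) -> uniq (a :: t) -> s = t.
Proof.
elim: s a t => [|y s IHs] a [|z t] //=.
- by move=> _ _ -> _ /andP[/negP[]]; rewrite mem_last.
- by move=> _ _ <- /andP[/negP[]]; rewrite mem_last.
case: (eqVneq y z) => [<-|yz] /andP[ays ps] /andP[azt pt] st
    /andP[a_s us] /andP[a_t ut].
  by rewrite (IHs y t).
have hs : has [in z :: t] (y :: s).
  by apply/hasP; exists (last y s); rewrite ?mem_last// st mem_last.
have [w [s1 [s2 [t1 [t2 [sE tE s1t]]]]]] : exists w s1 s2 t1 t2,
    [/\ y :: s = rcons s1 w ++ s2, z :: t = rcons t1 w ++ t2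
       & ~~ has [in z :: t] s1].
  have [w [s1 [s2 [-> wt s1t]]]] : exists w s1 s2,
      [/\ y :: s = rcons s1 w ++ s2, w \in z :: t & ~~ has [in z :: t] s1].
    by case/split_find: hs => w s1 s2 wt s1t; exists w, s1, s2.
  have [t1 [t2 tE]] : exists t1 t2, z :: t = rcons t1 w ++ t2.
    by case/path.splitP: wt => t1 t2; exists t1, t2.
  by exists w, s1, s2, t1, t2.
have ps' : path adj a (y :: s) by rewrite /= ays.
have pt' : path adj a (z :: t) by rewrite /= azt.
have [_ _ _ /(_ (a :: rcons s1 w ++ rev t1))] := tree.
suff /andP[szc cyc] : (2 < size (a :: rcons s1 w ++ rev t1))%N &&
    ucycleb adj (a :: rcons s1 w ++ rev t1).
  by move=> /(_ szc); rewrite cyc.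
have uas : uniq (a :: rcons s1 w ++ s2) by rewrite -sE /= inE a_s.
have uat : uniq (a :: rcons t1 w ++ t2) by rewrite -tE /= inE a_t.
rewrite sE in ps'; rewrite tE in pt' s1t.
apply/andP; split.
  (* Were [s1] and [t1] both empty, [w] would equal [y] and [z]; hence the cycle has a third
     node. *)
  move: sE tE; rewrite /= size_cat size_rcons size_rev.
  case: (s1) (t1) => [|? ?] [|? ?] //=.
  by move=> [yE _] [zE _]; rewrite yE zE eqxx in yz.
rewrite /ucycleb /= rcons_cat cat_path last_rcons.
move: ps' pt'; rewrite !cat_path => /andP[-> _] /andP[pt1 _] /=.
apply/andP; split.
  rewrite -rev_cons -[X in rev (X :: _)]/a -(belast_rcons a t1 w).
  by rewrite -[w in path _ w _](last_rcons a t1 w) rev_path (eq_path (e' := adj)).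
move: uas uat; rewrite /= !cat_uniq !rcons_uniq !mem_cat !mem_rcons !inE !negb_or.
rewrite rev_uniq mem_rev -!andbA.
move=> /and5P[-> -> _ -> /andP[-> _]] /and5P[_ -> _ wt1 /andP[-> _]] /=.
rewrite andbT -all_predC; apply/allP => g.
rewrite mem_rev /= mem_rcons inE negb_or => gt1.
apply/andP; split; first by apply: contraNneq wt1 => <-.
apply: contraNN s1t => gs1; apply/hasP; exists g => //.
by rewrite mem_cat mem_rcons inE gt1 orbT.
Qed.

(** Connectedness gives every node a simple path to the root, so the default [[::]] never steps
    in. *)
Definition root_path a : seq V := xget [::] [set s | is_root_path adj root a s].

Lemma root_pathP a : is_root_path adj root a (root_path a).
Proof.
suff [s sP] : exists s, is_root_path adj root a s.
  exact: (@xgetI _ [::] [set s | is_root_path adj root a s] s).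
have [_ _ conn _] := tree.
have /connectP[s ps lst] := conn a root.
case/shortenP: ps lst => s' ps' us' _ lst; exists s'.
by rewrite /is_root_path ps' -lst eqxx.
Qed.

Lemma root_path_unique a s : is_root_path adj root a s -> s = root_path a.
Proof.
case/and3P: (root_pathP a) => pr /eqP lr ur /and3P[ps /eqP ls us].
by apply: simple_path_unique ur; rewrite // ls.
Qed.

(** The default of [head] makes the root its own parent. *)
Definition parent a := head a (root_path a).

(* The root is left out: a node [u] of this set stands for the edge from [u] to
   its parent, which makes the set an encoding of [root_edges]. *)
Definition ancestors a : {set V} :=
  [set u | (u != root) && (u \in a :: root_path a)]%SET.

Lemma root_path_root : root_path root = [::].
Proof. by rewrite -(@root_path_unique _ [::])// /is_root_path /= eqxx. Qed.

Lemma root_pathE a : a != root -> root_path a = parent a :: root_path (parent a).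
Proof.
move=> ar; have := root_pathP a; rewrite /parent.
case: (root_path a) => [|g s] /and3P[/= ps ls us].
  by rewrite (eqP ls) eqxx in ar.
congr cons; apply: root_path_unique; case/andP: ps us => _ ps /andP[_ us].
exact/and3P.
Qed.

Lemma root_path_ind (K : V -> Prop) :
  K root -> (forall a, a != root -> K (parent a) -> K a) -> forall a, K a.
Proof.
move=> Kr Kp a; have [n] := ubnP (size (root_path a)).
elim: n a => // n IHn a; case: (eqVneq a root) => [->//|ar].
by rewrite root_pathE// => sz; apply: Kp => //; apply: IHn.
Qed.

Lemma adj_parent a : a != root -> adj a (parent a).
Proof.
by move=> ar; case/and3P: (root_pathP a); rewrite root_pathE//= => /andP[].
Qed.

(** If [g] is on the path from [a] to the root, the part up to [g] is a simple path, hence the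
    single edge; otherwise [g] followed by the path of [a] is the path of [g]. *)
Lemma adjP a g : adj a g ->
  (a != root /\ parent a = g) \/ (g != root /\ parent g = a).
Proof.
move=> ag; have /and3P[ps ls us] := root_pathP a.
have nag : g != a.
  by apply: contraTneq ag => ->; have [_ ->] := tree.
have [gs|gs] := boolP (g \in root_path a); [left|right].
  have ar : a != root by apply: contraTneq gs => ->; rewrite root_path_root.
  split=> //; rewrite /parent; case/path.splitP: gs ps us => s1 s2.
  rewrite cat_path => /andP[ps _]; rewrite -cat_cons cat_uniq => /andP[us _].
  rewrite -(@simple_path_unique a [:: g] (rcons s1 g))//= ?ag ?last_rcons//.
  by rewrite inE eq_sym nag.
have gE : is_root_path adj root g (a :: root_path a).
  by apply/and3P; split; rewrite //= ?inE ?negb_or ?nag ?gs// adjC ag.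
rewrite /parent -(root_path_unique gE); split=> //.
apply: contra_eq_neq (root_path_unique gE) => ->.
by rewrite root_path_root.
Qed.

(** Off the root, each step to the parent shortens the path to the root by one; the root, being its
    own parent, is treated apart. *)
Lemma parent_acyclic a : a != root -> parent (parent a) != a.
Proof.
move=> ar; have := congr1 size (root_pathE ar).
case: (eqVneq (parent a) root) => [par|par] sz; last first.
  apply/eqP => pp; move: sz; rewrite (root_pathE par) pp/=; move/eqP.
  by rewrite -addn2 -[X in X == _]addn0 eqn_add2l.
by rewrite par /parent root_path_root eq_sym.
Qed.

Lemma ancestors_root : ancestors root = finset.set0.
Proof.
by apply/setP => u; rewrite !inE root_path_root; case: eqP.
Qed.

Lemma ancestorsE a : a != root -> ancestors a = (a |: ancestors (parent a))%SET.
Proof.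
move=> ar; apply/setP => u; rewrite !inE root_pathE// !inE andb_orr.
by case: (eqVneq u a) => [->|_]; rewrite ?ar ?andbF.
Qed.

Lemma notin_ancestors_parent a : a != root -> a \notin ancestors (parent a).
Proof.
move=> ar; rewrite inE ar /= -root_pathE//.
by case/and3P: (root_pathP a) => _ _ /= /andP[].
Qed.

Lemma in_descendants a c :
  (c \in descendants adj root a) = (a \in c :: root_path c).
Proof.
rewrite inE; apply/asboolP/idP => [[s /root_path_unique ->//]|ac].
by exists (root_path c) => //; exact: root_pathP.
Qed.

Lemma is_parentP k a : is_parent adj root k a -> a != root /\ parent a = k.
Proof.
case/andP => ka; rewrite in_descendants => kDa.
have [[kr pk]|//] := adjP ka.
by have := notin_ancestors_parent kr; rewrite inE kr pk kDa.
Qed.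

(* Off its end point [a], each node of the path from the root to [a] has exactly
   one child on that path. *)
Lemma ancestors_parentE e a : e != root ->
  (e \in ancestors a : nat) =
  ((e == a) + \sum_(g in ancestors a) (parent g == e))%N.
Proof.
move=> er; elim/root_path_ind: a => [|a ar IH].
  by rewrite ancestors_root big_set0 inE (negPf er).
rewrite ancestorsE// big_setU1 ?notin_ancestors_parent//= [parent a == e]eq_sym.
rewrite -IH in_setU1; case: (eqVneq e a) => [->|//].
by rewrite (negPf (notin_ancestors_parent ar)).
Qed.

(** By [ancestors_parentE], an ancestor of [e] other than [e] has a child on the path from [e], but
    the only neighbour of a leaf is its own parent. *)
Lemma terminal_ancestors a e : terminal adj root a ->
  a \in ancestors e -> e = a.
Proof.
case/andP => ar /eqP/eq_leq/card_le1_eqP leaf ae.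
apply/eqP; rewrite eq_sym; apply: contraT => nea.
have [/existsP[g /andP[ge /eqP pg]]|noch] :=
    boolP [exists g, (g \in ancestors e) && (parent g == a)].
  have gr : g != root by move: ge; rewrite inE => /andP[].
  have gE : g = parent a.
    by apply: leaf; rewrite !inE ?adj_parent// adjC -pg adj_parent.
  by have := parent_acyclic ar; rewrite -gE pg eqxx.
have := ancestors_parentE e ar; rewrite ae (negPf nea) add0n big1// => g ge.
by move: noch => /existsPn/(_ g); rewrite ge /= => /negPf ->.
Qed.

Lemma subset_ancestors k e : e \in descendants adj root k ->
  ancestors k \subset ancestors e.
Proof.
rewrite in_descendants; elim/root_path_ind: e => [|e er IH].
  by rewrite root_path_root inE => /eqP ->.
rewrite root_pathE// inE => /predU1P[->//|/IH].
by move/fintype.subset_trans; apply; rewrite (ancestorsE er) finset.subsetUr.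
Qed.

Lemma root_edgesE a :
  root_edges adj root a = [set [set u; parent u] | u in ancestors a]%SET.
Proof.
pose up x y : {set V} := [set x; y]%SET.
have -> : root_edges adj root a = [set E in pairmap up a (root_path a)]%SET.
  apply/setP => E; rewrite !inE.
  apply/asboolP/idP => [[s /root_path_unique ->//]|].
  by exists (root_path a) => //; exact: root_pathP.
elim/root_path_ind: a => [|a ar IH].
  by rewrite root_path_root ancestors_root imset0; apply/setP => E; rewrite !inE.
rewrite root_pathE// ancestorsE// imsetU1 -IH.
by apply/setP => E; rewrite !inE.
Qed.

Lemma parent_edge_inj u w : u != root -> w != root ->
  [set u; parent u]%SET = [set w; parent w]%SET -> u = w.
Proof.
move=> ur wr E; apply/eqP; apply: contraT => uw.
have : u \in [set w; parent w]%SET by rewrite -E !inE eqxx.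
have : w \in [set u; parent u]%SET by rewrite E !inE eqxx.
rewrite !inE eq_sym (negPf uw) /= => /eqP wE /eqP uE.
by have := parent_acyclic ur; rewrite -wE -uE eqxx.
Qed.

Lemma mem_root_edges u a : u != root ->
  ([set u; parent u]%SET \in root_edges adj root a) = (u \in ancestors a).
Proof.
move=> ur; rewrite root_edgesE; apply/imsetP/idP => [[w wa]|ua]; last by exists u.
by have := wa; rewrite inE => /andP[wr _] /parent_edge_inj ->.
Qed.

End RootedTree.

(** * The inverse of the reduced Laplacian *)

Section LaplacianInverse.
Variables (R : realType) (V : finType) (adj : rel V) (root : V).
Hypothesis tree : is_tree adj.
Variable z : {set V} -> R.

Let adjC : symmetric adj. Proof. by case: tree. Qed.

Let par := parent adj root.
Let anc := ancestors adj root.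

(** This is M(e, f); each [u] accounts for the edge from [u] to its parent. *)
Definition shared_weight e f : R :=
  \sum_(u in anc e | u \in anc f) z [set u; par u]%SET.

Lemma shared_weight_root f : shared_weight root f = 0.
Proof.
by rewrite /shared_weight /anc ancestors_root// big_pred0// => u; rewrite inE.
Qed.

Lemma shared_weight_parent e f : e != root ->
  shared_weight e f =
  (if e \in anc f then z [set e; par e]%SET else 0) + shared_weight (par e) f.
Proof.
move=> er; rewrite /shared_weight !big_mkcondr /= /anc ancestorsE//.
by rewrite big_setU1 ?notin_ancestors_parent.
Qed.

Hypothesis z_neq0 : forall E, E \in edges adj -> z E != 0.

Lemma edges_adj e g : adj e g -> [set e; g]%SET \in edges adj.
Proof. by move=> eg; apply/imsetP; exists (e, g); rewrite ?inE. Qed.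

(** Along an edge, M(., f) jumps by the weight z of the edge if the path of [f] uses it, and by 0
    otherwise. Divided by z, the jumps at [e] count the edge above [e] minus those below [e] on that
    path, which is 1 at [e = f] and 0 elsewhere. *)
Lemma laplacian_shared_weight e f : e != root ->
  \sum_g laplacian adj (fun E => (z E)^-1) e g * shared_weight g f =
  (e == f)%:R.
Proof.
move=> er; have [_ irr _ _] := tree.
(* The diagonal entry is the sum of the weights at [e]; spreading it over the neighbours turns the
   row into weighted differences. *)
have -> : \sum_g laplacian adj (fun E => (z E)^-1) e g * shared_weight g f =
    \sum_(g | adj e g)
      (z [set e; g]%SET)^-1 * (shared_weight e f - shared_weight g f).
  rewrite (bigD1 e)//= {1}/laplacian eqxx mulr_suml.
  under [RHS]eq_bigr do rewrite mulrBr.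
  rewrite sumrB; congr (_ + _); rewrite -sumrN big_mkcond [RHS]big_mkcond /=.
  apply: eq_bigr => g _; rewrite /laplacian eq_sym.
  case: eqVneq => [<-|_]/=; first by rewrite irr.
  by case: ifP => _; rewrite ?mul0r// mulNr.
rewrite (bigD1 (par e)) ?adj_parent//= {1}(shared_weight_parent f er) addrK.
have -> : (z [set e; par e]%SET)^-1 *
    (if e \in anc f then z [set e; par e]%SET else 0) = (e \in anc f)%:R.
  by case: ifP => _; rewrite ?mulr0// mulVf// z_neq0// edges_adj// adj_parent.
(* The membership of [e] in [anc f] is traded for [e == f] plus the number of children of [e] in
   [anc f], which the terms of the child edges cancel. *)
rewrite (ancestors_parentE tree f er) natrD natr_sum -addrA.
rewrite [X in _ + X](_ : _ = 0) ?addr0//.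
apply/eqP; rewrite addr_eq0 -sumrN; apply/eqP.
have chE g : (adj e g && (g != par e)) = (g != root) && (par g == e).
  apply/andP/andP => [[eg gp]|[gr /eqP pg]].
    have [[_ pe]|[gr <-]] := adjP root tree eg; last by rewrite gr eqxx.
    by rewrite /par pe eqxx in gp.
  rewrite -pg /par adjC adj_parent//; split=> //.
  by rewrite eq_sym parent_acyclic.
rewrite (eq_bigl _ _ chE) big_mkcond [RHS]big_mkcondr [RHS]big_mkcond /=.
apply: eq_bigr => g _; rewrite -/anc.
have [gr|/negPn/eqP->] := boolP (g != root); last by rewrite inE eqxx.
rewrite /= -/par; case: eqVneq => [<-|_]; last by case: ifP.
rewrite (shared_weight_parent f gr) opprD addrCA subrr addr0.
case: ifP => _; rewrite ?oppr0 ?mulr0 ?oppr0// mulrN opprK.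
rewrite [X in z X]finset.setUC mulVf//.
by rewrite z_neq0// edges_adj// adj_parent.
Qed.

Lemma sum_nonroot (F : V -> R) :
  \sum_(g | g != root) F g = \sum_(g : nonroot root) F (val g).
Proof.
rewrite (reindex_omap (val : nonroot root -> V) insub) => [|g gr]; last first.
  by rewrite insubT.
by apply: eq_bigl => g; rewrite valK eqxx (valP g).
Qed.

Lemma invmx_reduced_laplacian :
  invmx (reduced_laplacian adj root (fun E => (z E)^-1)) =
  \matrix_(i, j) shared_weight (val (enum_val i)) (val (enum_val j)).
Proof.
set H := reduced_laplacian _ _ _; set M := (\matrix_(i, j) _)%R.
have HM : H *m M = 1%:M.
  apply/matrixP => i j; rewrite !mxE -(inj_eq enum_val_inj) -val_eqE.
  rewrite -laplacian_shared_weight; last exact: (valP (enum_val i)).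
  (* Removing the column of the root is harmless because M(root, f) = 0. *)
  rewrite [RHS](bigD1 root)//= shared_weight_root mulr0 add0r.
  by rewrite sum_nonroot [RHS]big_enum_val; apply: eq_bigr => k _; rewrite !mxE.
have [uH _] := mulmx1_unit HM.
by rewrite -[LHS]mulmx1 -HM mulKmx.
Qed.

End LaplacianInverse.

(** * Shared weights of sibling leaves *)

Section SharedWeight.
Variables (R : realType) (V : finType) (adj : rel V) (root : V).
Hypothesis tree : is_tree adj.
Variable z : {set V} -> R.

Let par := parent adj root.
Let anc := ancestors adj root.
Let M := shared_weight adj root z.

Lemma shared_weightC e f : M e f = M f e.
Proof. by apply: eq_bigl => u; rewrite andbC. Qed.

(** The edge above a leaf lies on no path to the root but its own, so only edges from the parent
    upwards can be shared. *)
Lemma shared_weight_terminal a e : terminal adj root a -> e != a ->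
  M a e = M (par a) e.
Proof.
move=> ta ea; have /andP[ar _] := ta.
rewrite /M shared_weight_parent//.
case: ifP => [/(terminal_ancestors tree ta)/eqP|_].
  by rewrite (negPf ea).
by rewrite add0r.
Qed.

(** A diagonal entry of M is the weight of a whole path to the root, and the path of [k] is
    contained in that of [e]. *)
Lemma path_sumE k e : e \in descendants adj root k ->
  path_sum adj root z k e = M e e - M k k.
Proof.
move=> ke; have ske := subset_ancestors tree ke.
have selfE g : M g g = \sum_(u in anc g) z [set u; par u]%SET.
  by apply: eq_bigl => u; rewrite andbb.
rewrite !selfE.
have -> : path_sum adj root z k e =
    \sum_(u in anc e | u \notin anc k) z [set u; par u]%SET.
  have ancr u : u \in anc e -> u != root by rewrite inE => /andP[].
  rewrite /path_sum (eq_bigl (fun E => (E \in root_edges adj root e)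
    && (E \notin root_edges adj root k))); last by move=> E; rewrite inE andbC.
  rewrite (root_edgesE root tree e) big_imset_cond/=; last first.
    by move=> u w /ancr ur /ancr wr; exact: (parent_edge_inj tree).
  by apply: eq_bigl => u; apply: andb_id2l => /ancr/(mem_root_edges tree) ->.
rewrite (bigID [in anc k] (mem (anc e)))/= addrAC.
rewrite [X in X - _ + _](eq_bigl [in anc k]) ?subrr ?add0r// => u /=.
by apply/andb_idl => uk; apply: (fintype.subsetP ske).
Qed.

Lemma shared_weight_meet k1 k2 c :
  root_edges adj root k1 :&: root_edges adj root c = root_edges adj root k2 ->
  M k1 c = M k2 k2.
Proof.
move=> meetE; apply: eq_bigl => u; rewrite /anc andbb.
have [->|ur] := eqVneq u root; first by rewrite !inE eqxx.
by rewrite -!(mem_root_edges tree _ ur) -meetE finset.in_setI.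
Qed.

(** The path of [a] meets that of [c] in the path of [k2] and that of [b] in the path of [k1], so
    M(c, a) = M(k2, k2) and M(b, a) = M(k1, k1); [path_sumE] reads the differences as path
    weights. *)
Lemma shared_weight_siblings a b c k1 k2 :
  b != a -> c != a -> terminal adj root a -> terminal adj root b ->
  is_parent adj root k1 a -> is_parent adj root k1 b ->
  k1 \in descendants adj root k2 ->
  root_edges adj root k1 :&: root_edges adj root c = root_edges adj root k2 ->
  M a a - M c a = path_sum adj root z k2 a /\
  M b a - M c a = path_sum adj root z k2 k1.
Proof.
move=> ba ca ta tb /(is_parentP tree)[ar ka] /(is_parentP tree)[br kb] k12 meetE.
have k1a : k1 != a.
  by apply/eqP => E; have := parent_acyclic tree ar; rewrite ka E ka E eqxx.
have caE : M c a = M k2 k2.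
  by rewrite shared_weightC shared_weight_terminal// /par ka
     (shared_weight_meet meetE).
have baE : M b a = M k1 k1.
  rewrite shared_weight_terminal 1?eq_sym// /par kb shared_weightC.
  by rewrite shared_weight_terminal// /par ka.
rewrite !path_sumE// ?caE ?baE//.
move: k12; rewrite !(in_descendants root tree) (root_pathE tree ar) ka.
by rewrite [in X in _ -> X]inE => ->; rewrite orbT.
Qed.

End SharedWeight.

(** * Second moments of linear combinations *)

Section Covariance.
Variables (d : measure_display) (T : measurableType d) (R : realType).
Variable P : probability T R.

Lemma Lfun2_Lfun1 (X : T -> R) : X \in Lfun P 2%:E -> X \in Lfun P 1.
Proof. by apply: Lfun_subset12; exact: fin_num_measure. Qed.

Lemma Lfun2Z c (X : T -> R) : X \in Lfun P 2%:E -> c *: X \in Lfun P 2%:E.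
Proof. by move=> X2; rewrite rpredZ ?lee1n. Qed.

Lemma Lfun2D (X Y : T -> R) : X \in Lfun P 2%:E -> Y \in Lfun P 2%:E ->
  X + Y \in Lfun P 2%:E.
Proof. by move=> X2 Y2; rewrite rpredD ?lee1n. Qed.

Lemma Lfun2_sum (I : Type) (s : seq I) (X : I -> T -> R) :
  (forall i, X i \in Lfun P 2%:E) -> \sum_(i <- s) X i \in Lfun P 2%:E.
Proof. by move=> X2; rewrite rpred_sum ?lee1n. Qed.

(** Finite second moments make covariances finite, so the algebra can be done on real numbers under
    [fine]. *)
Lemma covariance_fineK (X Y : T -> R) : X \in Lfun P 2%:E -> Y \in Lfun P 2%:E ->
  (fine (covariance P X Y))%:E = covariance P X Y.
Proof.
move=> X2 Y2; rewrite fineK//; apply: covariance_fin_num;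
  by [exact: Lfun2_Lfun1 | exact: (Lfun2_mul_Lfun1 X2 Y2)].
Qed.

Lemma fine_covarianceZl c (X Y : T -> R) :
  X \in Lfun P 2%:E -> Y \in Lfun P 2%:E ->
  fine (covariance P (c *: X) Y) = c * fine (covariance P X Y).
Proof.
move=> X2 Y2.
have -> : c *: X = (c \o* X)%R by apply/funext => w; rewrite /= mulrC.
rewrite covarianceZl ?(Lfun2_Lfun1 X2) ?(Lfun2_Lfun1 Y2)//.
  by rewrite -(covariance_fineK X2 Y2).
exact: (Lfun2_mul_Lfun1 X2 Y2).
Qed.

Lemma fine_covarianceDl (X Y Z : T -> R) :
  X \in Lfun P 2%:E -> Y \in Lfun P 2%:E -> Z \in Lfun P 2%:E ->
  fine (covariance P (X + Y) Z) =
  fine (covariance P X Z) + fine (covariance P Y Z).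
Proof.
move=> X2 Y2 Z2; rewrite (@covarianceDl _ _ _ P X Y Z)//.
by rewrite -(covariance_fineK X2 Z2) -(covariance_fineK Y2 Z2).
Qed.

Lemma fine_covariance_suml (I : finType) (X : I -> T -> R) (Y : T -> R) :
  (forall i, X i \in Lfun P 2%:E) -> Y \in Lfun P 2%:E ->
  fine (covariance P (\sum_i X i) Y) = \sum_i fine (covariance P (X i) Y).
Proof.
move=> X2 Y2.
elim: (index_enum I) => [|i s IHs].
  by rewrite !big_nil (_ : 0 = cst 0) ?covariance_cst_l.
by rewrite !big_cons fine_covarianceDl ?IHs ?Lfun2_sum.
Qed.

Lemma fine_covarianceC (X Y : T -> R) :
  fine (covariance P X Y) = fine (covariance P Y X).
Proof. by rewrite covarianceC. Qed.

(** In the bilinear expansion all pairs of distinct indices vanish; on the diagonal [X i] and [Y i]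
    may be correlated, and the two mixed terms merge into the one with factor 2. *)
Lemma fine_variance_lincomb (I : finType) (X Y : I -> T -> R) (al be : I -> R) :
  (forall i, X i \in Lfun P 2%:E) -> (forall i, Y i \in Lfun P 2%:E) ->
  (forall i j, i != j -> covariance P (X i) (X j) = 0%E) ->
  (forall i j, i != j -> covariance P (Y i) (Y j) = 0%E) ->
  (forall i j, i != j -> covariance P (Y i) (X j) = 0%E) ->
  let Z := \sum_i (al i *: X i + be i *: Y i) in
  fine (covariance P Z Z) =
  \sum_i (al i ^+ 2 * fine (covariance P (X i) (X i))
          + be i ^+ 2 * fine (covariance P (Y i) (Y i))
          + 2 * al i * be i * fine (covariance P (X i) (Y i))).
Proof.
move=> X2 Y2 XX YY YX /=.
pose W i := al i *: X i + be i *: Y i.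
have W2 i : W i \in Lfun P 2%:E by rewrite Lfun2D ?Lfun2Z.
have WE i j : fine (covariance P (W i) (W j)) =
    al i * (al j * fine (covariance P (X i) (X j))
            + be j * fine (covariance P (Y j) (X i)))
    + be i * (al j * fine (covariance P (Y i) (X j))
              + be j * fine (covariance P (Y i) (Y j))).
  rewrite fine_covarianceDl ?Lfun2Z// !fine_covarianceZl//.
  rewrite ![fine (covariance P _ (W j))]fine_covarianceC.
  rewrite !fine_covarianceDl ?Lfun2Z// !fine_covarianceZl//.
  by rewrite [fine (covariance P (X j) (X i))]fine_covarianceC
     [fine (covariance P (X j) (Y i))]fine_covarianceC
     [fine (covariance P (Y j) (Y i))]fine_covarianceC.
rewrite (fine_covariance_suml W2) ?Lfun2_sum//; apply: eq_bigr => i _.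
rewrite fine_covarianceC (fine_covariance_suml W2)// (bigD1 i)//= big1 ?addr0.
  by rewrite WE [fine (covariance P (Y i) (X i))]fine_covarianceC; ring.
move=> j ji; rewrite WE XX// YY// !YX//; last by rewrite eq_sym.
by rewrite /= !mulr0 !addr0 !mulr0 addr0.
Qed.

(** [phi] centres the two voltages separately, the covariance centres their difference; linearity of
    the expectation identifies the two. *)
Lemma phi_covariance (V : finType) (v : V -> T -> R) e f :
  v e \in Lfun P 1 -> v f \in Lfun P 1 ->
  phi P v e f = covariance P (v e - v f) (v e - v f).
Proof.
move=> e1 f1; rewrite /phi [in RHS]unlock; congr expectation; apply/funext => w.
rewrite -[v e - v f]/(v e \- v f) expectationB// fineB ?expectation_fin_num//.
transitivity ((v e w - v f w - (fine 'E_P[v e]%E - fine 'E_P[v f]%E)) ^+ 2);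
  last by [].
ring.
Qed.

End Covariance.

(** * Voltages as combinations of the injections *)

Section LinearCoupledPowerFlow.
Variables (V : finType) (adj : rel V) (root : V) (R : realType).
Variables (r x : {set V} -> R).
Variables (d : measure_display) (T : measurableType d) (P : probability T R).
Variables (p q : nonroot root -> {RV P >-> R}) (v : V -> T -> R).
Hypotheses (tree : is_tree adj)
  (r_gt0 : forall E, E \in edges adj -> 0 < r E)
  (x_gt0 : forall E, E \in edges adj -> 0 < x E)
  (p2 : forall e, (p e : T -> R) \in Lfun P 2%:E)
  (q2 : forall e, (q e : T -> R) \in Lfun P 2%:E)
  (pf : lcpf adj r x p q v).

Let rM := shared_weight adj root r.
Let xM := shared_weight adj root x.

Lemma lcpf_voltage (e : nonroot root) : v (val e) =
  \sum_g (rM (val e) (val g) *: (p g : T -> R)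
          + xM (val e) (val g) *: (q g : T -> R)).
Proof.
have invE (z : {set V} -> R) : (forall E, E \in edges adj -> 0 < z E) ->
    invmx (reduced_laplacian adj root (fun E => (z E)^-1)) =
    \matrix_(i, j) shared_weight adj root z (val (enum_val i)) (val (enum_val j)).
  by move=> z_gt0; apply: invmx_reduced_laplacian => // E /z_gt0/lt0r_neq0.
apply/funext => w; have /matrixP/(_ (enum_rank e) ord0) := pf.2 w.
rewrite (invE r r_gt0) (invE x x_gt0) !mxE enum_rankK => ->.
rewrite fct_sumE big_split /=; congr (_ + _);
  rewrite [RHS]big_enum_val; apply: eq_bigr => i _; by rewrite !mxE enum_rankK.
Qed.

(** The difference of two voltages is again a combination of the injections, with differences of
    entries of M as coefficients, so [fine_variance_lincomb] applies. *)
Lemma phi_lcpf (e f : nonroot root) :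
  (forall g h, g != h -> covariance P (p g) (p h) = 0%E) ->
  (forall g h, g != h -> covariance P (q g) (q h) = 0%E) ->
  (forall g h, g != h -> covariance P (q g) (p h) = 0%E) ->
  phi P v (val e) (val f) =
  (\sum_g ((rM (val e) (val g) - rM (val f) (val g)) ^+ 2
              * fine (covariance P (p g) (p g))
            + (xM (val e) (val g) - xM (val f) (val g)) ^+ 2
              * fine (covariance P (q g) (q g))
            + 2 * (rM (val e) (val g) - rM (val f) (val g))
              * (xM (val e) (val g) - xM (val f) (val g))
              * fine (covariance P (p g) (q g))))%:E.
Proof.
move=> pp qq qp.
have v2 (g : nonroot root) : v (val g) \in Lfun P 2%:E.
  by rewrite lcpf_voltage Lfun2_sum// => h; rewrite Lfun2D ?Lfun2Z.
rewrite phi_covariance ?Lfun2_Lfun1// -covariance_fineK; last 2 first.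
- by rewrite Lfun2D// -scaleN1r Lfun2Z.
- by rewrite Lfun2D// -scaleN1r Lfun2Z.
rewrite -fine_variance_lincomb// !lcpf_voltage -sumrB.
have -> : \sum_g ((rM (val e) (val g) - rM (val f) (val g)) *: (p g : T -> R)
      + (xM (val e) (val g) - xM (val f) (val g)) *: (q g : T -> R)) =
    \sum_g ((rM (val e) (val g) *: (p g : T -> R)
             + xM (val e) (val g) *: (q g : T -> R))
            - (rM (val f) (val g) *: (p g : T -> R)
               + xM (val f) (val g) *: (q g : T -> R))).
  by apply: eq_bigr => g _; rewrite !scalerBl opprD addrACA.
by [].
Qed.

End LinearCoupledPowerFlow.

(** * Comparison of the two sibling leaves *)

Theorem theorem2
  (V : finType) (adj : rel V) (root : V) (R : realType)
  (r x : {set V} -> R)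
  (d : measure_display) (Omega : measurableType d) (P : probability Omega R)
  (p q : nonroot root -> {RV P >-> R}) (v : V -> Omega -> R)
  (Htree : is_tree adj)
  (Hr : forall E, E \in edges adj -> 0 < r E)
  (Hx : forall E, E \in edges adj -> 0 < x E)
  (Hp2 : forall e, (p e : Omega -> R) \in Lfun P 2%:E)
  (Hq2 : forall e, (q e : Omega -> R) \in Lfun P 2%:E)
  (Hv : lcpf adj r x p q v)
  (Hpp : forall e f : nonroot root, e != f -> covariance P (p e) (p f) = 0%E)
  (Hqq : forall e f : nonroot root, e != f -> covariance P (q e) (q f) = 0%E)
  (Hqp : forall e f : nonroot root, e != f -> covariance P (q e) (p f) = 0%E)
  (a b c : nonroot root) (k1 k2 : V)
  (Hab : a != b) (Hca : c != a) (Hcb : c != b)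
  (Ha : terminal adj root (val a))
  (Hb : terminal adj root (val b))
  (Hc : terminal adj root (val c))
  (Hk1a : is_parent adj root k1 (val a))
  (Hk1b : is_parent adj root k1 (val b))
  (Hk2 : intermediate adj root k2)
  (Hck2 : val c \in descendants adj root k2)
  (Hk1k2 : k1 \in descendants adj root k2)
  (Hpaths : root_edges adj root k1 :&: root_edges adj root (val c)
            = root_edges adj root k2) :
  let rs := path_sum adj root r k2 in
  let xs := path_sum adj root x k2 in
  (phi P v (val a) (val c) - phi P v (val b) (val c) =
     covariance P (p a) (p a) * (rs (val a) ^+ 2 - rs k1 ^+ 2)%:E
     + covariance P (q a) (q a) * (xs (val a) ^+ 2 - xs k1 ^+ 2)%:E
     + 2%:E * covariance P (p a) (q a)
         * (rs (val a) * xs (val a) - rs k1 * xs k1)%:E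
     - covariance P (p b) (p b) * (rs (val b) ^+ 2 - rs k1 ^+ 2)%:E
     - covariance P (q b) (q b) * (xs (val b) ^+ 2 - xs k1 ^+ 2)%:E
     - 2%:E * covariance P (p b) (q b)
         * (rs (val b) * xs (val b) - rs k1 * xs k1)%:E)%E.
Proof.
move=> rs xs.
have [ba ca cb] : [/\ val b != val a, val c != val a & val c != val b].
  by rewrite !val_eqE eq_sym.
have ab : val a != val b by rewrite eq_sym.
(* For each weight the lemma is used twice, the second time with [a] and [b] exchanged, to cover
   both [g = a] and [g = b]. *)
have [raa rba] := shared_weight_siblings Htree r ba ca Ha Hb Hk1a Hk1b Hk1k2 Hpaths.
have [rbb rab] := shared_weight_siblings Htree r ab cb Hb Ha Hk1b Hk1a Hk1k2 Hpaths.
have [xaa xba] := shared_weight_siblings Htree x ba ca Ha Hb Hk1a Hk1b Hk1k2 Hpaths.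
have [xbb xab] := shared_weight_siblings Htree x ab cb Hb Ha Hk1b Hk1a Hk1k2 Hpaths.
rewrite -(covariance_fineK (Hp2 a) (Hp2 a)) -(covariance_fineK (Hp2 b) (Hp2 b)).
rewrite -(covariance_fineK (Hq2 a) (Hq2 a)) -(covariance_fineK (Hq2 b) (Hq2 b)).
rewrite -(covariance_fineK (Hp2 a) (Hq2 a)) -(covariance_fineK (Hp2 b) (Hq2 b)).
rewrite !(phi_lcpf Htree Hr Hx Hp2 Hq2 Hv)// -EFinB.
rewrite -!EFinM -?EFinD -?EFinB -?EFinD -?EFinB; congr EFin.
(* At [g = a], the term of [phi] for [a] and [c] brings the path from [a] to [k2], and that for [b]
   and [c] the path from [k1] to [k2]; at [g = b] these roles are exchanged, whence the opposite
   signs. *)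
rewrite -sumrB (bigD1 a)//= (bigD1 b) 1?eq_sym//= big1 ?addr0.
  by rewrite raa rba rbb rab xaa xba xbb xab /rs /xs; ring.
move=> g /andP[ga gb].
(* As [g] is neither [a] nor [b], both leaves can be replaced by their common parent; this includes
   [g = c]. *)
have sib (z : {set V} -> R) : shared_weight adj root z (val a) (val g) =
    shared_weight adj root z (val b) (val g).
  rewrite (shared_weight_terminal Htree z Ha ga).
  rewrite (shared_weight_terminal Htree z Hb gb).
  by rewrite (is_parentP Htree Hk1a).2 (is_parentP Htree Hk1b).2.
by rewrite !sib subrr.
Qed.
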